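(* Let $G$ be a finite group. Then $G\in D(0)$ if and only if one of the following statements holds: (1) $G$ is an abelian group and either $G=\{1\}$, or $G\cong C_p$ for some prime $p$; (2) $G$ is a non-abelian group and $G=C_p\rtimes C_q$ is a Frobenius group, with $p$ and $q$ distinct primes.
   Context: For a group $G$ put $G^{*}=G\setminus\{1\}$. An element $x\in G^{*}$ is called deficient if $\langle x\rangle < C_G(x)$ (proper inclusion), and non-deficient if $\langle x\rangle = C_G(x)$; the conjugacy class $x^G$ is called deficient (non-deficient) if $x$ is. For a non-negative integer $j$, $G\in D(j)$ means that exactly $j$ non-trivial conjugacy classes of $G$ are deficient. In particular $G\in D(0)$ means that $C_G(x)=\langle x\rangle$ for every $x\in G^{*}$. $C_n$ denotes the cyclic group of order $n$. The phrase ''$G=A\rtimes B$ is a Frobenius group'' means that $G$ is a finite Frobenius group with kernel $A$ and a complement $B$. Equalities of groups with named groups mean isomorphism. *)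

(* Defs.v *)
From mathcomp Require Import all_boot all_fingroup all_solvable.

Set Implicit Arguments.
Unset Strict Implicit.
Unset Printing Implicit Defensive.

Local Open Scope group_scope.

Definition deficient (gT : finGroupType) (G : {group gT}) (x : gT) : bool :=
  (x \in G^#) && (<[x]> \proper 'C_G[x]).

(* Deficiency is invariant under conjugation in G, so the set below contains
   a class exactly when all of its elements are deficient. *)
Definition deficient_classes (gT : finGroupType) (G : {group gT}) :
    {set {set gT}} :=
  [set x ^: G | x in G & deficient G x].

Definition in_D (j : nat) (gT : finGroupType) (G : {group gT}) : Prop :=
  #|deficient_classes G| = j.

(* Main.v *)
Require Import Defs.
From mathcomp Require Import all_boot all_algebra all_fingroup all_solvable.
From mathcomp Require Import vcharacter.

(** The condition [in_D 0 G] says that every nontrivial centraliser [C_G(x)]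
    is [<x>].  It is extremely restrictive because it passes to subgroups, and
    because a nontrivial nilpotent group satisfying it has prime order: such a
    group centralises a nontrivial central element [z], so it is [<z>], and
    every nontrivial element has prime order, since a power [y] of [x] of prime
    order satisfies [x \in C(y) = <y>].  In particular the Sylow subgroups of
    [G] have prime order.

    Solvability of [G] follows by induction on the order.  A Sylow subgroup [P]
    for the smallest prime divisor [p] is its own centraliser, so [N_G(P) / P]
    embeds in [Aut P], of order [p - 1], whereas its order has no prime divisor
    below [p]: hence [P] is self-normalising.  Being of prime order, [P] also
    meets its other conjugates trivially, so either [G = P] or [P] is a
    Frobenius complement.  In the latter case Frobenius' theorem gives a proper
    normal subgroup [K] with [G / K] isomorphic to [P], and induction applies
    to [K].

    If [G] is solvable and not abelian, its Fitting subgroup [F] is nilpotent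
    and nontrivial, hence of prime order, a Sylow subgroup, and equal to its own
    centraliser.  A complement [H] of [F] (Schur-Zassenhaus) acts faithfully
    on [F], so it embeds in the cyclic group [Aut F]; being abelian it has
    prime order, and it acts freely because [C_F(h)] lies in [<h>], which
    meets [F] trivially.

    Conversely, in a Frobenius group the centraliser of a nontrivial element
    lies in the kernel or in a conjugate of the complement, and here these
    have prime order. *)

Local Open Scope group_scope.

Section SelfCentralisingElements.

Set Implicit Arguments.
Unset Strict Implicit.

Context {gT : finGroupType}.
Implicit Types (G H K P : {group gT}) (x y : gT).

(** The inclusion form of [C_G(x) = <x>], which is visibly inherited by
    subgroups. *)
Definition cycle_cent1 G := {in G^#, forall x, 'C_G[x] \subset <[x]>}.

Lemma in_D0P G : in_D 0 G <-> cycle_cent1 G.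
Proof.
rewrite /in_D; split=> [/eqP | centG].
  rewrite cards_eq0 => /eqP noDef x G1x; have /setD1P[_ Gx] := G1x.
  rewrite -[_ \subset _]negbK; apply/negP=> not_sCx.
  have: x ^: G \in deficient_classes G.
    apply: imset_f; rewrite inE Gx /deficient G1x properE not_sCx andbT.
    by rewrite cycle_subG inE Gx cent1id.
  by rewrite noDef inE.
apply/eqP; rewrite cards_eq0 -subset0; apply/subsetP=> X /imsetP[x].
by case/setIdP=> _ /andP[G1x /andP[_ /negP]] /(_ (centG x G1x)).
Qed.

Lemma cycle_cent1S G H : H \subset G -> cycle_cent1 G -> cycle_cent1 H.
Proof.
move=> sHG centG x /setD1P[nt_x Hx].
apply: subset_trans (setSI _ sHG) (centG x _).
by rewrite !inE nt_x (subsetP sHG).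
Qed.

(** A power [y] of [x] of prime order is centralised by [x], so [x] lies in
    [<y>], whose order is prime. *)
Lemma cycle_cent1_prime_order G x :
  cycle_cent1 G -> x \in G^# -> prime #[x].
Proof.
move=> centG /setD1P[nt_x Gx]; set p := pdiv #[x].
have p_pr: prime p by rewrite pdiv_prime // order_gt1.
have [y xy oy] := Cauchy p_pr (pdiv_dvd #[x]).
have Gy: y \in G by apply: subsetP xy; rewrite cycle_subG.
have nt_y: y != 1 by rewrite -order_gt1 oy prime_gt1.
have yx: x \in <[y]>.
  apply: (subsetP (centG y _)); first by rewrite !inE nt_y.
  by rewrite inE Gx cent1C -cent_cycle (subsetP (cycle_abelian x)).
have := order_dvdG yx; rewrite -orderE oy => dv_xp.
by rewrite (prime_nt_dvdP p_pr _ dv_xp) // order_eq1.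
Qed.

(** A central element [z != 1] generates its centraliser, which is [G]. *)
Lemma cycle_cent1_nil G :
  cycle_cent1 G -> nilpotent G -> G :!=: 1 -> prime #|G|.
Proof.
move=> centG nilG ntG.
have /trivgPn[z Zz nt_z]: 'Z(G) != 1 by rewrite center_nil_eq1.
have [Gz cGz] := setIP Zz; have G1z: z \in G^# by rewrite !inE nt_z.
suffices ->: G :=: <[z]> by apply: cycle_cent1_prime_order G1z.
apply/eqP; rewrite eqEsubset cycle_subG Gz andbT.
apply: subset_trans (centG z G1z).
by rewrite subsetI subxx -cent_set1 centsC sub1set.
Qed.

Lemma cycle_cent1_Sylow p G P :
  cycle_cent1 G -> p.-Sylow(G) P -> P :!=: 1 -> #|P| = p.
Proof.
move=> centG sylP ntP; have pP := pHall_pgroup sylP.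
have P_pr: prime #|P|.
  by rewrite cycle_cent1_nil ?(pgroup_nil pP) //; apply: cycle_cent1S centG;
     apply: pHall_sub sylP.
have [p_pr p_dv _] := pgroup_pdiv pP ntP.
by apply/esym/eqP; rewrite -dvdn_prime2.
Qed.

Lemma cycle_cent1_cent G P :
  cycle_cent1 G -> P \subset G -> prime #|P| -> 'C_G(P) = P.
Proof.
move=> centG sPG P_pr.
have /trivgPn[z Pz nt_z]: P :!=: 1 by rewrite -cardG_gt1 prime_gt1.
have P1z: z \in P^# by rewrite !inE nt_z.
have defP := nt_gen_prime P_pr P1z.
have abP: abelian P by rewrite cyclic_abelian ?prime_cyclic.
apply/eqP; rewrite eqEsubset subsetI sPG [P \subset 'C(P)]abP andbT.
by rewrite defP cent_cycle centG // !inE nt_z (subsetP sPG).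
Qed.

(** As [P] is its own centraliser, ['N_G(P) / P] embeds in [Aut P], so a prime
    divisor of its order would divide [p - 1], although it is at least [p]. *)
Lemma cycle_cent1_norm_Sylow G P (p := pdiv #|G|) :
  cycle_cent1 G -> p.-Sylow(G) P -> P :!=: 1 -> 'N_G(P) = P.
Proof.
move=> centG sylP ntP; have oP := cycle_cent1_Sylow centG sylP ntP.
have sPG := pHall_sub sylP.
have [p_pr _ _] := pgroup_pdiv (pHall_pgroup sylP) ntP.
have P_pr: prime #|P| by rewrite oP.
have sPN: P \subset 'N_G(P) by rewrite subsetI sPG normG.
apply/eqP; rewrite eqEsubset sPN andbT -indexg_eq1.
have dv_p1: #|'N_G(P) : P| %| p.-1.
  have <-: #|Aut P| = p.-1.
    by rewrite card_Aut_cyclic ?prime_cyclic // oP totient_prime.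
  have := cardSg (Aut_conj_aut P 'N_G(P)).
  rewrite card_morphim ker_conj_aut (setIidPr (subsetIr _ _)).
  by rewrite -indexgI -setIA (setIidPr (cent_sub _)) (cycle_cent1_cent centG).
apply/contraT=> ntN; set r := pdiv #|'N_G(P) : P|.
have r_pr: prime r by rewrite pdiv_prime // ltn_neqAle eq_sym ntN indexg_gt0.
have le_pr: p <= r.
  rewrite pdiv_min_dvd ?prime_gt1 // (dvdn_trans (pdiv_dvd _)) //.
  by rewrite (dvdn_trans (dvdn_indexg _ _)) ?cardSg ?subsetIl.
have p1_gt0: 0 < p.-1 by rewrite -ltnS prednK ?prime_gt1 ?prime_gt0.
have := dvdn_leq p1_gt0 (dvdn_trans (pdiv_dvd _) dv_p1).
by rewrite leqNgt prednK ?prime_gt0 // le_pr.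
Qed.

(** If the Sylow subgroup [P] for the smallest prime is proper, then it is a
    Frobenius complement: its nontrivial elements all generate it, so an
    element conjugating one of them into [P] normalises [P]. *)
Lemma cycle_cent1_sol G : cycle_cent1 G -> solvable G.
Proof.
have [n] := ubnP #|G|; elim: n G => // n IHn G /ltnSE-leGn centG.
have [-> | ntG] := eqVneq G 1%G; first exact: solvable1.
have [P sylP] := Sylow_exists (pdiv #|G|) G; have sPG := pHall_sub sylP.
have p_pr: prime (pdiv #|G|) by rewrite pdiv_prime // cardG_gt1.
have ntP: P :!=: 1.
  rewrite -cardG_gt1 (card_Hall sylP) p_part_gt1.
  by rewrite mem_primes p_pr cardG_gt0 pdiv_dvd.
have P_pr: prime #|P| by rewrite (cycle_cent1_Sylow centG sylP ntP).
have abP: abelian P by rewrite cyclic_abelian ?prime_cyclic.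
have defN := cycle_cent1_norm_Sylow centG sylP ntP.
have [<- | neqPG] := eqVneq (P : {set gT}) G; first exact: abelian_sol.
have frobP: [Frobenius G with complement P].
  rewrite /Frobenius_group_with_complement neqPG.
  apply/normedTI_memJ_P; split=> // [|x g P1x Gg].
    by rewrite setD_eq0 subG1.
  apply/idP/idP=> [P1xg | Pg]; last first.
    by rewrite memJ_norm // normD1 (subsetP (normG P)).
  rewrite -defN inE Gg; apply/normP.
  by rewrite {1}(nt_gen_prime P_pr P1x) -cycleJ -(nt_gen_prime P_pr P1xg).
have [K frobG] := Frobenius_kernel_exists frobP.
have [defG _ _ sKG _] := Frobenius_context frobG.
have [nsKG _ _ _ _] := sdprod_context defG.
rewrite (series_sol nsKG) -(isog_sol (sdprod_isog defG)).
rewrite (abelian_sol abP) andbT.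
apply: IHn (cycle_cent1S (normal_sub nsKG) centG).
exact: leq_trans (proper_card sKG) leGn.
Qed.

(** The kernel is the Fitting subgroup, which is a self-centralising Sylow
    subgroup of prime order; a complement embeds in its cyclic automorphism
    group, so it is abelian, hence of prime order too. *)
Lemma cycle_cent1_Frobenius G :
    cycle_cent1 G -> ~~ abelian G ->
  exists K H : {group gT},
    [/\ [Frobenius G = K ><| H], prime #|K| & prime #|H|].
Proof.
move=> centG not_abG; have solG := cycle_cent1_sol centG.
have ntG: G :!=: 1 by apply: contraNneq not_abG => ->; apply: abelian1.
have nsFG: 'F(G) <| G := Fitting_normal G; have sFG := normal_sub nsFG.
have F_pr: prime #|'F(G)|.
  apply: cycle_cent1_nil (cycle_cent1S sFG centG) (Fitting_nil G) _.
  by rewrite trivg_Fitting.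
have ntF: 'F(G) != 1 by rewrite trivg_Fitting.
(* A Sylow subgroup containing 'F(G) has prime order, so it is equal to it. *)
have hallF: Hall G 'F(G).
  have pF: #|'F(G)|.-group 'F(G) by apply: pnat_id.
  have [P sylP sFP] := Sylow_superset sFG pF.
  have ntP: P :!=: 1 by apply: subG1_contra sFP ntF.
  have oP := cycle_cent1_Sylow centG sylP ntP.
  have -> : 'F(G) = P by apply/eqP; rewrite eqEcard sFP oP /=.
  exact: pHall_Hall sylP.
have /splitsP[H complH] := SchurZassenhaus_split hallF nsFG.
have [tiFH defG] := complP complH.
have sHG: H \subset G by rewrite -defG mulG_subr.
have nFH: H \subset 'N('F(G)) := subset_trans sHG (normal_norm nsFG).
have ntH: H :!=: 1.
  apply: contraNneq not_abG => H1; rewrite -defG H1 mulg1.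
  by rewrite cyclic_abelian ?prime_cyclic.
have abH: abelian H.
  have [f [_ kerf _ imf]] := restrmP (conj_aut_morphism 'F(G)) nFH.
  have injf: 'injm f.
    rewrite kerf ker_conj_aut -(setIidPl sHG) -setIA.
    by rewrite (cycle_cent1_cent centG sFG F_pr) setIC tiFH.
  rewrite -(injm_abelian injf (subxx H)) imf //.
  exact: abelianS (Aut_conj_aut _ _) (Aut_cyclic_abelian (prime_cyclic F_pr)).
have H_pr: prime #|H|.
  exact: cycle_cent1_nil (cycle_cent1S sHG centG) (abelian_nil abH) ntH.
exists 'F(G)%G, H; split=> //.
apply/Frobenius_semiregularP=> //; first by rewrite sdprodE.
move=> h /setD1P[nt_h Hh]; apply/trivgP; rewrite -tiFH subsetI subsetIl /=.
have Gh := subsetP sHG h Hh.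
rewrite (subset_trans (setSI _ sFG)) // (subset_trans (centG h _)) //.
  by rewrite !inE nt_h.
by rewrite cycle_subG.
Qed.

Lemma prime_cycle_cent1 G : prime #|G| -> cycle_cent1 G.
Proof. by move=> G_pr x G1x; rewrite -(nt_gen_prime G_pr G1x) subsetIl. Qed.

(** Every element of [G] lies in [K] or in a conjugate of [H], and these
    contain the centralisers of their nontrivial elements. *)
Lemma Frobenius_cycle_cent1 G K H :
    [Frobenius G = K ><| H] -> cycle_cent1 K -> cycle_cent1 H -> cycle_cent1 G.
Proof.
move=> frobG centK centH x /setD1P[nt_x Gx].
have [defG _ _ _ _] := Frobenius_context frobG.
have [nsKG _ _ _ _] := sdprod_context defG.
have [/eqP covG _ _] := and3P (Frobenius_partition frobG).
have: x \in cover (gval K |: (H^# :^: K)) by rewrite covG.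
case/bigcupP=> _ /setU1P[-> | /imsetP[k Kk ->]].
  move=> Kx; have K1x: x \in K^# by rewrite !inE nt_x.
  apply: subset_trans (centK x K1x).
  by rewrite subsetI subsetIr (Frobenius_cent1_ker frobG K1x).
case/imsetP=> y H1y def_x.
have sCH: 'C_G[y] \subset H.
  have [_ tiH] := andP (FrobeniusWcompl frobG).
  exact: cent1_normedTI tiH y H1y.
have Gk := subsetP (normal_sub nsKG) k Kk.
rewrite def_x cent1J cycleJ -{1}(conjGid Gk) -conjIg conjSg.
by apply: subset_trans (centH y H1y); rewrite subsetI subsetIr sCH.
Qed.

End SelfCentralisingElements.

Lemma isog_Zp_prime (gT : finGroupType) (G : {group gT}) (p : nat) :
  prime p -> G \isog Zp p -> #|G| = p.
Proof. by move=> p_pr /card_isog->; rewrite card_Zp ?prime_gt0. Qed.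

Lemma prime_isog_Zp (gT : finGroupType) (G : {group gT}) :
  prime #|G| -> G \isog Zp #|G|.
Proof.
move=> G_pr; have [x ->] := cyclicP (prime_cyclic G_pr).
by rewrite isog_sym Zp_isog.
Qed.

Theorem theorem1 (gT : finGroupType) (G : {group gT}) :
  in_D 0 G <->
  (abelian G /\ (G :=: 1 \/ exists2 p : nat, prime p & G \isog Zp p)) \/
  (~~ abelian G /\
   exists p q : nat, [/\ prime p, prime q, p != q &
     exists K H : {group gT},
       [/\ [Frobenius G = K ><| H], K \isog Zp p & H \isog Zp q]]).
Proof.
apply: (iff_trans (in_D0P G)); split=> [centG | ].
  have [abG | not_abG] := boolP (abelian G); [left | right]; split=> //.
    have [-> | ntG] := eqVneq (G : {set gT}) 1; [by left | right].
    have G_pr := cycle_cent1_nil centG (abelian_nil abG) ntG.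
    by exists #|G|; last exact: prime_isog_Zp.
  have [K [H [frobG K_pr H_pr]]] := cycle_cent1_Frobenius centG not_abG.
  exists #|K|, #|H|; split=> //.
    have := Frobenius_coprime frobG.
    by rewrite prime_coprime // dvdn_prime2.
  by exists K, H; split; rewrite // prime_isog_Zp.
case=> [[_ [G1 | [p p_pr isoG]]] | [_ [p [q [p_pr q_pr _ exKH]]]]].
- by move=> x; rewrite G1 setDv inE.
- by apply: prime_cycle_cent1; rewrite (isog_Zp_prime p_pr).
have [K [H [frobG isoK isoH]]] := exKH.
by apply: Frobenius_cycle_cent1 frobG _ _; apply: prime_cycle_cent1;
  rewrite ?(isog_Zp_prime p_pr isoK) ?(isog_Zp_prime q_pr isoH).
Qed.
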